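(* Let $q>13$ be an odd prime power and let $S_2=\{x^2: x\in\mathbb{F}_q^*\}$ be the set of nonzero squares in $\mathbb{F}_q$. Then there is no subset $A\subset\mathbb{F}_q$ with $A\hat{+}A=S_2$.
   Context: For $A\subset\mathbb{F}_q$, the restricted sumset is $A\hat{+}A=\{a+b: a,b\in A,\ a\neq b\}$. *)

(* Defs.v *)
From mathcomp Require Import all_boot all_order all_algebra.

Set Implicit Arguments.
Unset Strict Implicit.
Unset Printing Implicit Defensive.

Import GRing.Theory.
Local Open Scope ring_scope.

Definition restricted_sumset (F : finFieldType) (A : {set F}) : {set F} :=
  [set a + b | a in A, b in A & a != b].

Definition nonzero_squares (F : finFieldType) : {set F} :=
  [set x ^+ 2 | x in [set x : F | x != 0]].

(* Main.v *)
Require Import Defs.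
From mathcomp Require Import all_boot all_order all_algebra.
From mathcomp Require Import finfield zify ring lra.

(* Let [q = #|F|], [N = #|A|], [M = (q - 1) / 2], let [chi] be the quadratic
   character, and call [a] in [A] bad if [chi (2 a) = -1].  Counting sums gives
   [q - 1 <= N (N - 1)], and the second moment of [S x = \sum_(a in A) chi (x + a)]
   shows that some [a] is bad.

   Stepanov's method is applied to
   [f = \sum_a c_a a^eps (X + a)^(M + k - 1) (X - a)^k], where the [c_a] are the
   Lagrange weights of [A] and [eps <= 1].  The factor [(X - a)^k] hides the
   uncontrolled diagonal values [chi (2 a)], so [f] minus a constant vanishes to
   order [k] on [A], while the weights lower the degree of [f] to about [M].  When
   [f] is forced to be constant, its [k]-th Taylor coefficient at [l] in [A] gives
   [c_l (chi (2 l) - 1) = (-1)^eps B (2 l) / P (- l)], with [B] a binomial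
   coefficient and [P] the polynomial with root set [A].  Taking [eps = 0] and
   [k = N / 2] shows that every nonzero element of [A] is bad.  If [N] is odd and
   [q - 1 < N (N - 1)], then [eps = 1] is also allowed and the two signs clash.  If
   [N] is even, the parity of [S] outside [A] and [- A] sharpens the second moment
   to [q >= N^2 - N - 1], and in the case of equality summing the relation over [A]
   gives [p | N], hence [p | q + 1].  So [q = N^2 - N + 1].

   Then [A] is a perfect difference set, every square is [a + b] in exactly one
   way, and no [2 a] is a square.  Expanding [#{(b, c) | 2 b - 2 c = 2 l} = 1] by
   these facts gives [|S l + S (- l)| = 1] for nonzero [l] in [A]; but [S l = N - 2]
   while [\sum_(l in A) S (- l) = 0], so [N <= 4] and [q <= 13]. *)

Set Implicit Arguments.
Unset Strict Implicit.
Unset Printing Implicit Defensive.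

Import Order.TTheory GRing.Theory Num.Theory.
Local Open Scope ring_scope.

(** Translation by [1] permutes [F] and so preserves the sum of all elements, while it adds [1] once
    per element. *)
Lemma natr_card_finField (F : finFieldType) : #|F|%:R = 0 :> F.
Proof.
have : \sum_(x : F) (x + 1) = \sum_(x : F) x.
  rewrite [RHS](reindex_inj (h := fun x => x + 1)) //; exact: addIr.
by rewrite big_split /= sumr_const -[RHS]addr0 => /addrI.
Qed.

Lemma sumr_shift (F : finFieldType) (V : nmodType) (f : F -> V) (t : F) :
  \sum_x f (x + t) = \sum_x f x.
Proof. by rewrite [RHS](reindex_inj (h := fun x => x + t)) //; apply: addIr. Qed.

(** * Euler's criterion, the quadratic character and its correlations *)

Section QuadraticCharacter.

Variable F : finFieldType.
Hypothesis oddF : odd #|F|.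

Notation q := #|F|.
Notation M := (#|F|.-1./2).

Lemma card_odd_field : q = M.*2.+1.
Proof.
have q0 : (0 < q)%N by apply/card_gt0P; exists 0.
lia.
Qed.

Lemma half_card_gt0 : (0 < M)%N.
Proof. have q1 : (1 < q)%N := finNzRing_gt1 F; have := card_odd_field; lia. Qed.

Lemma two_neq0 : (2 : F) != 0.
Proof.
apply/negP=> /eqP h2; have := natr_card_finField F.
rewrite card_odd_field -addn1 -muln2 natrD natrM h2 mulr0 add0r.
by apply/eqP; rewrite oner_eq0.
Qed.

Lemma neq_opp1 : (1 : F) != -1.
Proof. by rewrite -addr_eq0; apply: two_neq0. Qed.

Lemma neq0_expf_half (x : F) : x != 0 -> (x ^+ M == 1) || (x ^+ M == -1).
Proof.
move=> x0; rewrite -eqf_sqr expr1n -exprM muln2.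
have e : x * x ^+ M.*2 = x * 1 by rewrite mulr1 -exprS -card_odd_field expf_card.
by rewrite (mulfI x0 e).
Qed.

(** Euler's criterion. Squares are roots of [X^M - 1], which has at most [M] roots, and there are at
    least [M] squares because squaring is at most two-to-one on the [2M] nonzero elements. *)
Lemma nonzero_squaresE (x : F) :
  (x \in nonzero_squares F) = (x != 0) && (x ^+ M == 1).
Proof.
have sqP y : y \in nonzero_squares F -> (y != 0) && (y ^+ M == 1).
  case/imsetP=> z; rewrite inE => z0 ->; rewrite expf_neq0 //=.
  by rewrite exprAC; case/orP: (neq0_expf_half z0) => /eqP ->; rewrite ?sqrrN expr1n.
pose E := [set y : F | (y != 0) && (y ^+ M == 1)].
have leM : (#|E| <= M)%N.
  have := @max_poly_roots F ('X^M - 1) (enum E).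
  rewrite -cardE size_XnsubC ?half_card_gt0 // ltnS; apply.
  - by rewrite -size_poly_eq0 size_XnsubC ?half_card_gt0.
  - apply/allP=> y; rewrite mem_enum inE => /andP[_ /eqP yM].
    by rewrite /root !hornerE yM subrr.
  - exact: enum_uniq.
have geM : (M <= #|nonzero_squares F|)%N.
  have h : (\sum_(y in [set y : F | y != 0%R]) 1 <= \sum_(y in nonzero_squares F) 2)%N.
    rewrite (partition_big_imset (fun y : F => y ^+ 2)) /=.
    apply: leq_sum => _ /imsetP[z _ ->].
    rewrite sum1dep_card -[2%N]/(1.+1); apply: leq_trans (_ : #|[set z; -z]| <= _)%N.
      apply/subset_leq_card/subsetP => y.
      by rewrite !inE eqf_sqr => /andP[].
    by rewrite cards2; case: (_ == _).
  move: h; rewrite sum1_card sum_nat_const.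
  have -> : [set y : F | y != 0] = ~: [set 0] by apply/setP=> y; rewrite !inE.
  rewrite cardsC1 card_odd_field; lia.
have /eqP -> : nonzero_squares F == E.
  rewrite eqEcard (leq_trans leM geM) andbT.
  by apply/subsetP=> y /sqP; rewrite inE.
by rewrite inE.
Qed.

(** The values lie in [int], not in [F], so that character sums can be bounded; [chiE] gives the
    link back to [F]. *)
Definition chi (x : F) : int :=
  if x == 0 then 0 else if x ^+ M == 1 then 1 else -1.

Lemma chi0 : chi 0 = 0. Proof. by rewrite /chi eqxx. Qed.

Lemma chi1 : chi 1 = 1. Proof. by rewrite /chi oner_eq0 expr1n eqxx. Qed.

Lemma chiE (x : F) : x ^+ M = (chi x)%:~R.
Proof.
rewrite /chi; case: eqVneq => [->|x0]; first by rewrite expr0n gtn_eqF ?half_card_gt0.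
by case: eqP => [->//|/eqP n1]; have := neq0_expf_half x0; rewrite (negPf n1) => /eqP.
Qed.

Lemma chi_neq0 (x : F) : x != 0 -> chi x = 1 \/ chi x = -1.
Proof. by rewrite /chi => /negPf ->; case: ifP; [left | right]. Qed.

Lemma chi_eq1 (x : F) : (chi x == 1) = (x \in nonzero_squares F).
Proof. by rewrite nonzero_squaresE /chi; case: (x == 0) => //=; case: (x ^+ M == 1). Qed.

Definition is_sign (u : int) := [\/ u = 0, u = 1 | u = -1].

Lemma is_sign_chi (x : F) : is_sign (chi x).
Proof.
by rewrite /chi; case: ifP => _; [exact: Or31|case: ifP => _; [exact: Or32|exact: Or33]].
Qed.

(** In odd characteristic [-1], [0] and [1] stay distinct in [F], so identities between signs can be
    checked in [F], where [chi] is a power map. *)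
Lemma intr_sign_inj (u v : int) :
  is_sign u -> is_sign v -> u%:~R = v%:~R :> F -> u = v.
Proof.
have n1 := neq_opp1; have i1 : (1 : F) != 0 := oner_neq0 F.
case=> -> [] -> // /eqP; rewrite ?rmorphN /= ?mulr1z ?mulr0z //.
- by rewrite eq_sym (negPf i1).
- by rewrite eq_sym oppr_eq0 (negPf i1).
- by rewrite (negPf i1).
- by rewrite (negPf n1).
- by rewrite oppr_eq0 (negPf i1).
- by rewrite eq_sym (negPf n1).
Qed.

Lemma chiM (x y : F) : chi (x * y) = chi x * chi y.
Proof.
apply: intr_sign_inj; first exact: is_sign_chi.
  by case: (is_sign_chi x) (is_sign_chi y) => -> [] ->;
    first [exact: Or31 | exact: Or32 | exact: Or33].
by rewrite -chiE exprMn !chiE intrM.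
Qed.

Lemma chi_sqr (x : F) : x != 0 -> chi x * chi x = 1.
Proof. by move/chi_neq0 => [] ->. Qed.

Lemma exists_nonsquare : exists2 g : F, g != 0 & chi g = -1.
Proof.
have : ~~ [forall g : F, (g != 0) ==> (g ^+ M == 1)].
  apply/negP=> /forallP h.
  have := @max_poly_roots F ('X^M - 1) (enum (~: [set (0 : F)])).
  rewrite -cardE size_XnsubC ?half_card_gt0 // ltnS cardsC1.
  have lM : (q.-1 <= M)%N = false.
    by have := half_card_gt0; rewrite {3}card_odd_field; lia.
  rewrite lM => H; suff : false by []; apply: H.
  - by rewrite -size_poly_eq0 size_XnsubC ?half_card_gt0.
  - apply/allP=> y; rewrite mem_enum !inE => y0.
    by have := h y; rewrite y0 /root !hornerE => /eqP ->; rewrite subrr.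
  - exact: enum_uniq.
case/forallPn=> g; rewrite negb_imply => /andP[g0 gM]; exists g => //.
by rewrite /chi (negPf g0) (negPf gM).
Qed.

(** Multiplication by a nonsquare permutes [F] and negates the sum. *)
Lemma sum_chi : \sum_x chi x = 0.
Proof.
have [g g0 cg] := exists_nonsquare.
have : \sum_x chi (g * x) = \sum_x chi x.
  by rewrite [RHS](reindex_inj (mulfI g0)).
under eq_bigr do rewrite chiM cg.
rewrite -mulr_sumr; move: (\sum_x chi x) => s; lia.
Qed.

Lemma sum_chi_shift (t : F) : \sum_x chi (x + t) = 0.
Proof. by rewrite (sumr_shift chi) sum_chi. Qed.

(** For nonzero [x] the summand is [chi (1 + t / x)], and [t / x] runs over all nonzero elements;
    the full sum of [chi (y + 1)] is [0], and its missing term at [y = 0] is [1]. *)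
Lemma sum_chi_mul_shift (t : F) : t != 0 -> \sum_x chi x * chi (x + t) = -1.
Proof.
move=> t0; rewrite (bigD1 0) //= chi0 mul0r add0r.
transitivity (\sum_(x | x != 0) chi (1 + t * x^-1)).
  apply: eq_bigr => x x0.
  have -> : x + t = x * (1 + t * x^-1) by rewrite mulrDr mulr1 mulrCA divff ?mulr1.
  by rewrite chiM mulrA chi_sqr // mul1r.
rewrite (reindex_inj (h := fun y : F => t * y^-1)) /=; last first.
  by move=> x y /(mulfI t0)/invr_inj.
have h := sum_chi_shift 1; rewrite (bigD1 0) //= add0r chi1 in h.
have -> : \sum_(j | t / j != 0) chi (1 + t / (t / j)) = \sum_(j | j != 0) chi (j + 1).
  apply: eq_big => [x|x x0]; first by rewrite mulf_eq0 (negPf t0) invr_eq0.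
  by rewrite invf_div mulrCA divff // mulr1 addrC.
by apply/eqP; rewrite -addr_eq0 addrC h.
Qed.

Lemma sum_chi_shift2 (a b : F) :
  \sum_x chi (x + a) * chi (x + b) = if a == b then q%:Z - 1 else -1.
Proof.
case: eqVneq => [<-|nab]; last first.
  rewrite -(@sum_chi_mul_shift (b - a)) ?subr_eq0 1?eq_sym //.
  rewrite -[RHS](sumr_shift _ a); apply: eq_bigr => x _.
  by rewrite -addrA [a + _]addrC subrK.
rewrite (sumr_shift (fun x => chi x * chi x)) (bigD1 0) //= chi0 mul0r add0r.
rewrite (eq_bigr (fun=> 1)) => [|x x0]; last exact: chi_sqr.
by rewrite sumr_const (cardC1 0) card_odd_field /=; lia.
Qed.

Lemma nonzero_squares_indicator (x : F) :
  1 + chi x - (x == 0)%:R = 2 * (x \in nonzero_squares F)%:R.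
Proof.
by rewrite -chi_eq1; have [->|/chi_neq0[]->] := eqVneq x 0; rewrite ?chi0.
Qed.

End QuadraticCharacter.

(** * Lagrange weights and their moments *)

Section Interpolation.

Variables (F : finFieldType) (A : {set F}).

Definition lagrange_weight (a : F) : F := (\prod_(b in A :\ a) (a - b))^-1.

Lemma lagrange_weight_neq0 (a : F) : lagrange_weight a != 0.
Proof.
rewrite invr_eq0; apply/prodf_neq0 => b; rewrite !inE => /andP[nba _].
by rewrite subr_eq0 eq_sym.
Qed.

Lemma size_prod_XsubC_set (B : {set F}) :
  size (\prod_(b in B) ('X - b%:P)) = #|B|.+1.
Proof. by rewrite -big_enum size_prod_XsubC -cardE. Qed.

Lemma horner_prod_XsubC_set (B : {set F}) (x : F) :
  (\prod_(b in B) ('X - b%:P)).[x] = \prod_(b in B) (x - b).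
Proof. by rewrite horner_prod; apply: eq_bigr => b _; rewrite hornerXsubC. Qed.

Lemma prod_sub_eq0 (B : {set F}) (x : F) : (\prod_(b in B) (x - b) == 0) = (x \in B).
Proof.
apply/idP/idP => [/prodf_eq0[b bB]|xB]; first by rewrite subr_eq0 => /eqP ->.
by rewrite (bigD1 x) //= subrr mul0r.
Qed.

Lemma lagrange_interpolation (Q : {poly F}) : (size Q <= #|A|)%N ->
  Q = \sum_(a in A) (lagrange_weight a * Q.[a]) *: \prod_(b in A :\ a) ('X - b%:P).
Proof.
move=> sQ; apply/eqP; rewrite -subr_eq0; apply/eqP.
apply: (@roots_geq_poly_eq0 _ _ (enum A)); last 2 first.
- exact: enum_uniq.
- rewrite -cardE; apply: leq_trans (size_polyD _ _) _; rewrite size_polyN geq_max sQ /=.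
  apply: leq_trans (size_sum _ _ _) _; apply/bigmax_leqP => a aA.
  apply: leq_trans (size_scale_leq _ _) _; rewrite size_prod_XsubC_set.
  by rewrite [X in (_ <= X)%N](cardsD1 a) aA.
apply/allP=> c; rewrite mem_enum => cA; rewrite /root hornerD hornerN horner_sum.
rewrite (bigD1 c) //= [X in _ - (_ + X)]big1 ?addr0 => [|a /andP[aA nac]].
  rewrite hornerZ horner_prod_XsubC_set mulrAC /lagrange_weight mulVf ?mul1r ?subrr //.
  by rewrite -invr_eq0 lagrange_weight_neq0.
rewrite hornerZ horner_prod_XsubC_set; apply/eqP; rewrite mulf_eq0 prod_sub_eq0.
by rewrite !inE [c == a]eq_sym nac cA orbT.
Qed.

(** Compare top coefficients in the interpolation formula. The sum vanishes on polynomials of degree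
    below [#|A| - 1], which is the source of all later cancellations. *)
Lemma sum_lagrange_weight (Q : {poly F}) : (size Q <= #|A|)%N ->
  \sum_(a in A) lagrange_weight a * Q.[a] = Q`_(#|A|.-1).
Proof.
move=> sQ; rewrite [in RHS](lagrange_interpolation sQ) coef_sum.
apply: eq_bigr => a aA; rewrite coefZ.
have mon : \prod_(b in A :\ a) ('X - b%:P) \is monic.
  by rewrite -big_enum monic_prod_XsubC.
have -> : #|A|.-1 = (size (\prod_(b in A :\ a) ('X - b%:P))).-1.
  by rewrite size_prod_XsubC_set (cardsD1 a A) aA.
by rewrite -[(\prod_(b in A :\ a) ('X - b%:P))`_ _]/(lead_coef _) (monicP mon) mulr1.
Qed.

(** Partial fractions of the inverse of the polynomial with root set [A], obtained by interpolating
    the constant [1]. *)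
Lemma sum_lagrange_weight_div (y : F) : A != set0 -> y \notin A ->
  \sum_(a in A) lagrange_weight a / (y - a) = (\prod_(b in A) (y - b))^-1.
Proof.
move=> A0 yA; have P0 : \prod_(b in A) (y - b) != 0 by rewrite prod_sub_eq0.
have s1 : (size (1 : {poly F})%R <= #|A|)%N by rewrite size_poly1 card_gt0.
have /(congr1 (horner^~ y)) := lagrange_interpolation s1.
rewrite horner_sum hornerC => e; apply: (mulIf P0); rewrite mulVf // [RHS]e mulr_suml.
apply: eq_bigr => a aA; rewrite hornerZ horner_prod_XsubC_set hornerC mulr1.
rewrite (big_setD1 a) //= mulrA mulfVK // subr_eq0; apply: contraNneq yA => -> //.
Qed.

End Interpolation.

(** * Coefficients and divisibility for powers of linear polynomials *)

Lemma coef_XaddC_exp (R : comNzRingType) (s : R) (m u : nat) :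
  (('X + s%:P) ^+ m)`_u = s ^+ (m - u) *+ 'C(m, u).
Proof.
rewrite addrC exprDn coef_sum.
case: (ltnP u m.+1) => um.
  rewrite (bigD1 (Ordinal um)) //= big1 => [|i ni].
    by rewrite addr0 coefMn -polyC_exp coefCM coefXn eqxx mulr1.
  rewrite coefMn -polyC_exp coefCM coefXn; case: eqVneq => [e|]; last by rewrite mulr0 mul0rn.
  by case/eqP: ni; apply: val_inj.
rewrite bin_small // mulr0n big1 // => i _.
by rewrite coefMn -polyC_exp coefCM coefXn gtn_eqF ?mulr0 ?mul0rn // (leq_trans (ltn_ord i)).
Qed.

Lemma dvdp_prod_XsubC_exp (F : fieldType) (s : seq F) (k : nat) (p : {poly F}) :
  uniq s -> (forall l, l \in s -> ('X - l%:P) ^+ k %| p) ->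
  \prod_(l <- s) ('X - l%:P) ^+ k %| p.
Proof.
elim: s => [|l s IHs]; first by rewrite big_nil dvd1p.
rewrite /= => /andP[ls us] h; rewrite big_cons Gauss_dvdp.
  by rewrite h ?mem_head //= IHs // => l' l's; apply: h; rewrite inE l's orbT.
apply: coprimep_expl; rewrite big_seq; elim/big_rec: _ => [|l' x l's cx].
  exact: coprimep1.
rewrite coprimepMr cx andbT; apply: coprimep_expr.
by rewrite coprimep_XsubC root_XsubC; apply: contraNneq ls => <-.
Qed.

Lemma monicXaddC (F : fieldType) (s : F) : 'X + s%:P \is monic.
Proof. by rewrite -[s]opprK polyCN monicXsubC. Qed.

Lemma size_XaddC_exp (F : fieldType) (s : F) (n : nat) : size (('X + s%:P) ^+ n) = n.+1.
Proof. by rewrite -[s]opprK polyCN size_exp_XsubC. Qed.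

Lemma size_XaddC_exp_mul (F : fieldType) (s t : F) (m n : nat) :
  size (('X + s%:P) ^+ m * ('X + t%:P) ^+ n) = (m + n).+1.
Proof.
rewrite size_mul ?size_XaddC_exp //; first by rewrite addnS.
all: by rewrite -size_poly_gt0 size_XaddC_exp.
Qed.

Lemma coef_XaddC_exp_mul (F : fieldType) (s t : F) (m n j : nat) :
  (('X + s%:P) ^+ m * ('X + t%:P) ^+ n)`_j =
  \sum_(u < j.+1) (s ^+ (m - u) * t ^+ (n - (j - u))) *+ ('C(m, u) * 'C(n, j - u)).
Proof.
rewrite coefM; apply: eq_bigr => u _; rewrite !coef_XaddC_exp.
by rewrite mulrnAl mulrnAr -mulrnA mulnC.
Qed.

(** * Stepanov's auxiliary polynomial *)

Section Stepanov.

Variable F : finFieldType.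
Hypothesis oddF : odd #|F|.
Variable A : {set F}.

Notation M := (#|F|.-1./2).
Notation N := #|A|.

Hypothesis sumA : {in A &, forall a b, a != b -> (a + b) ^+ M = 1}.

Variables (k : nat) (eps : bool).
Hypothesis k_gt0 : (0 < k)%N.
Hypothesis leN : (k.*2 + eps <= N)%N.

Notation w a := (lagrange_weight A a * a ^+ eps).

Definition stepanov_poly : {poly F} :=
  \sum_(a in A) w a *: (('X + a%:P) ^+ (M + k.-1) * ('X + (- a)%:P) ^+ k).

Lemma sum_weight (Q : {poly F}) : (size Q + eps <= N)%N ->
  \sum_(a in A) w a * Q.[a] = (Q * 'X^eps)`_N.-1.
Proof.
move=> sQ; rewrite -sum_lagrange_weight.
  by apply: eq_bigr => a _; rewrite hornerM hornerXn -mulrA [_ * Q.[a]]mulrC.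
have [->|Q0] := eqVneq Q 0; first by rewrite mul0r size_poly0.
by rewrite size_mulXn // addnC.
Qed.

Lemma sum_weight_eq0 (Q : {poly F}) : (size Q + eps < N)%N ->
  \sum_(a in A) w a * Q.[a] = 0.
Proof.
move=> sQ; rewrite sum_weight ?(ltnW sQ) // coefMXn; case: ifP => // h.
by rewrite nth_default //; move: (size Q) sQ h => n; lia.
Qed.

(** Up to a scalar, every contribution to the coefficient of [X^j] is the weighted moment of
    [a ^ (M + 2k - 1 - j)], which vanishes when this exponent is below [N - 1 - eps]. *)
Lemma size_stepanov_poly : (size stepanov_poly <= (M + k.*2 + eps - N).+1)%N.
Proof.
apply/leq_sizeP => j jN; rewrite coef_sum.
under eq_bigr do rewrite coefZ coef_XaddC_exp_mul mulr_sumr.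
rewrite exchange_big big1 // => u _ /=.
under eq_bigr do rewrite mulrnAr.
rewrite sumrMnl.
case: (leqP u (M + k.-1)) => hu; last by rewrite bin_small.
case: (leqP (j - u) k) => hj; last by rewrite [X in (_ * X)%N]bin_small // muln0.
have lt_uj := ltn_ord u.
rewrite (eq_bigr (fun a => (-1) ^+ (k - (j - u)) * (w a * ('X^(M + k.-1 + k - j)).[a]))).
  rewrite -mulr_sumr sum_weight_eq0 ?mulr0 ?mul0rn // size_polyXn; lia.
move=> a _; rewrite hornerXn [(- a) ^+ _]exprNn.
have -> : (M + k.-1 + k - j = (M + k.-1 - u) + (k - (j - u)))%N by lia.
rewrite exprD; ring.
Qed.

Lemma comp_stepanov_poly (l : F) :
  stepanov_poly \Po ('X + l%:P) =
  \sum_(a in A) w a *: (('X + (l + a)%:P) ^+ (M + k.-1) * ('X + (l - a)%:P) ^+ k).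
Proof.
rewrite /stepanov_poly raddf_sum /=; apply: eq_bigr => a _.
rewrite comp_polyZ rmorphM /= !rmorphXn /= !rmorphD /= !comp_polyX !comp_polyC.
by rewrite -!addrA -!polyCD.
Qed.

Lemma coef_comp_stepanov_poly (l : F) (j : nat) :
  (stepanov_poly \Po ('X + l%:P))`_j =
  \sum_(u < j.+1) (\sum_(a in A)
     w a * ((l + a) ^+ (M + k.-1 - u) * (l - a) ^+ (k - (j - u))))
       *+ ('C(M + k.-1, u) * 'C(k, j - u)).
Proof.
rewrite comp_stepanov_poly coef_sum.
under eq_bigr do rewrite coefZ coef_XaddC_exp_mul mulr_sumr.
rewrite exchange_big; apply: eq_bigr => u _ /=.
by rewrite -sumrMnl; apply: eq_bigr => a _; rewrite mulrnAr.
Qed.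

(* The factor [(l - a) ^+ e] annihilates the only term [a = l] in which
   [(l + a) ^+ M] may differ from [1]. *)
Lemma sum_weight_half_power (l : F) (u e : nat) : l \in A -> (u < k)%N -> (0 < e)%N ->
  \sum_(a in A) w a * ((l + a) ^+ (M + k.-1 - u) * (l - a) ^+ e) =
  (-1) ^+ e * \sum_(a in A) w a * (('X + l%:P) ^+ (k.-1 - u) * ('X + (- l)%:P) ^+ e).[a].
Proof.
move=> lA uk e0; rewrite mulr_sumr; apply: eq_bigr => a aA.
rewrite hornerM !horner_exp !hornerD !hornerX !hornerC [RHS]mulrCA; congr (_ * _).
have [->|nal] := eqVneq a l; first by rewrite subrr expr0n gtn_eqF // !mulr0.
have -> : (M + k.-1 - u = M + (k.-1 - u))%N by lia.
rewrite exprD sumA // 1?eq_sym // mul1r -[l - a]opprB [(- (a - l)) ^+ e]exprNn.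
by rewrite [l + a]addrC mulrCA.
Qed.

(** Once the [M]-th powers are replaced by [1], only weighted sums of polynomials of degree
    [2k - 1 - j] remain, and for [j > 0] these degrees are too small to contribute. *)
Lemma coef_comp_stepanov_eq0 (l : F) (j : nat) : l \in A -> (0 < j < k)%N ->
  (stepanov_poly \Po ('X + l%:P))`_j = 0.
Proof.
move=> lA hj; rewrite coef_comp_stepanov_poly big1 // => u _.
have uj := ltn_ord u.
rewrite sum_weight_half_power //; try lia.
by rewrite sum_weight_eq0 ?mulr0 ?mul0rn // size_XaddC_exp_mul; lia.
Qed.

(** At order [0] the polynomial in [a] is monic of degree [2k - 1]. It reaches the critical degree
    [N - 1 - eps] exactly when [2k + eps = N], and then only the sign [(-1)^k] survives. *)
Definition stepanov_const : F := (-1) ^+ k *+ (k.*2 + eps == N).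

Lemma stepanov_value (l : F) : l \in A ->
  (stepanov_poly \Po ('X + l%:P))`_0 = stepanov_const.
Proof.
move=> lA; rewrite coef_comp_stepanov_poly big_ord1 /= !bin0 mulr1n.
have -> : (k - (0 - 0) = k)%N by rewrite subnn subn0.
rewrite sum_weight_half_power // sum_weight; last first.
  by rewrite size_XaddC_exp_mul; lia.
rewrite /stepanov_const -mulr_natr; congr (_ * _).
rewrite coefMXn ifF; last by lia.
rewrite subn0.
set Q := _ * _; have sQ : size Q = (k.-1 + k).+1 by rewrite size_XaddC_exp_mul.
have mQ : Q \is monic.
  by rewrite /Q rpredM // rpredX // monicXaddC.
case: eqP => hN.
  have -> : (N.-1 - eps = (size Q).-1)%N by lia.
  exact: monicP.
by rewrite nth_default // sQ; lia.
Qed.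

Lemma dvdp_stepanov (l : F) : l \in A ->
  ('X - l%:P) ^+ k %| stepanov_poly - stepanov_const%:P.
Proof.
move=> lA; set p := stepanov_poly - _.
have e : p = (p \Po ('X + l%:P)) \Po ('X - l%:P).
  have XE : ('X + l%:P) \Po ('X - l%:P) = 'X.
    by rewrite comp_polyD comp_polyX comp_polyC subrK.
  by rewrite -comp_polyA XE comp_polyXr.
have eshift : p \Po ('X + l%:P) = drop_poly k (p \Po ('X + l%:P)) * 'X^k.
  rewrite -{1}[p \Po _](poly_take_drop k); set t := take_poly _ _.
  suff -> : t = 0 by rewrite add0r.
  apply/polyP=> j; rewrite coef_take_poly coef0; case: ifP => // jk.
  rewrite comp_polyB coefB comp_polyC coefC.
  case: j jk => [|j] jk; first by rewrite stepanov_value // subrr.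
  by rewrite coef_comp_stepanov_eq0 // subr0.
rewrite e eshift comp_polyM comp_Xn_poly; exact: dvdp_mull.
Qed.

(** Zeros of order [k] at the [N] points of [A] outnumber the degree bound [M + 2k + eps - N]. *)
Lemma stepanov_polyC : (M + k.*2 + eps < N * k + N)%N ->
  stepanov_poly = stepanov_const%:P.
Proof.
move=> big; apply/eqP; rewrite -subr_eq0; apply/negPn/negP => nz.
have dv : \prod_(l <- enum A) ('X - l%:P) ^+ k %| stepanov_poly - stepanov_const%:P.
  apply: dvdp_prod_XsubC_exp; first exact: enum_uniq.
  by move=> l; rewrite mem_enum => /dvdp_stepanov.
have := dvdp_leq nz dv.
set g := stepanov_poly - _; have sf : (size g <= (M + k.*2 + eps - N).+1)%N.
  apply: leq_trans (size_polyD _ _) _; rewrite size_polyN geq_max size_stepanov_poly /=.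
  exact: leq_trans (size_polyC_leq1 _) _.
move/leq_trans/(_ sf); rewrite prodrXl; set G := \prod_(l <- _) _.
have : (size (G ^+ k)).-1 = (N * k)%N by rewrite size_exp size_prod_XsubC -cardE.
(* If the subtraction in the degree bound truncates to [0], the contradiction comes from
   [N * k > 0]. *)
move: (size (G ^+ k)) big leN k_gt0 => n; move: N M => N' M'; clear; nia.
Qed.

Lemma opp_notin (l : F) : l \in A -> l != 0 -> - l \notin A.
Proof.
move=> lA l0; apply/negP => lA'.
have nl : l != - l by rewrite -addr_eq0 -mulr2n -mulr_natl mulf_neq0 ?two_neq0.
have := sumA lA lA' nl; rewrite subrr expr0n gtn_eqF ?half_card_gt0 // => /eqP.
by rewrite eq_sym oner_eq0.
Qed.

(** Partial fractions at [- l]. For [eps = 1] write [a / (l + a) = 1 - l / (l + a)]; the weights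
    themselves sum to [0] because [N >= 3]. *)
Lemma sum_weight_div (l : F) : l \in A -> l != 0 ->
  \sum_(a in A) w a / (l + a) =
  - (-1) ^+ eps * l ^+ eps / \prod_(b in A) (- l - b).
Proof.
move=> lA l0; have lNA := opp_notin lA l0.
have A0 : A != set0 by apply/set0Pn; exists l.
have e0 : \sum_(a in A) lagrange_weight A a / (l + a) = - (\prod_(b in A) (- l - b))^-1.
  rewrite -sum_lagrange_weight_div // -sumrN; apply: eq_bigr => a _.
  by rewrite -opprD invrN mulrN opprK.
case: eps leN => leN'; last first.
  transitivity (\sum_(a in A) lagrange_weight A a / (l + a)).
    by apply: eq_bigr => a _; rewrite /= expr0 mulr1.
  by rewrite e0 /= !expr0 mulr1 mulN1r.
have e1 : \sum_(a in A) lagrange_weight A a = 0.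
  have := @sum_lagrange_weight F A 1; under eq_bigr do rewrite hornerC mulr1.
  rewrite size_poly1 coefC => ->; last by lia.
  by rewrite gtn_eqF //; lia.
have -> : \sum_(a in A) lagrange_weight A a * a ^+ true / (l + a) =
    \sum_(a in A) (lagrange_weight A a - l * (lagrange_weight A a / (l + a))).
  apply: eq_bigr => a aA; have la : l + a != 0.
    by apply: contraNneq lNA => /eqP; rewrite addr_eq0 => /eqP ->; rewrite opprK.
  by rewrite expr1; field.
by rewrite sumrB e1 -mulr_sumr e0; ring.
Qed.

(** The [k]-th Taylor coefficient at [l] of a constant is [0]. Among its terms only two survive:
    [u = 0], which has no factor killing the diagonal and so records [(2 * l) ^+ M - 1], and
    [u = k], where the exponent [M - 1] turns [(l + a)] into an inverse. *)
Lemma stepanov_relation (l : F) : (M + k.*2 + eps < N * k + N)%N ->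
  l \in A -> l != 0 ->
  lagrange_weight A l * ((2 * l) ^+ M - 1) =
  (-1) ^+ eps * 'C(M + k.-1, k)%:R * (2 * l) / \prod_(b in A) (- l - b).
Proof.
move=> big lA l0; have lNA := opp_notin lA l0.
have l2 : 2 * l != 0 by rewrite mulf_neq0 ?two_neq0.
have : (stepanov_poly \Po ('X + l%:P))`_k = 0.
  by rewrite stepanov_polyC // comp_polyC coefC gtn_eqF.
rewrite coef_comp_stepanov_poly big_ord_recr /= subnn subn0 bin0 muln1.
rewrite (bigD1 (Ordinal k_gt0)) //= [X in _ + X + _]big1 => [|u nu]; last first.
  have uk := ltn_ord u.
  have u0 : (0 < u)%N by rewrite lt0n; apply: contraNneq nu => u0; apply/eqP/val_inj.
  rewrite sum_weight_half_power //; try lia.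
  by rewrite sum_weight_eq0 ?mulr0 ?mul0rn // size_XaddC_exp_mul; lia.
rewrite addr0 !subn0 subnn bin0 binn mulr1n.
have -> : \sum_(a in A) w a * ((l + a) ^+ (M + k.-1) * (l - a) ^+ 0) =
    lagrange_weight A l * l ^+ eps * ((2 * l) ^+ M - 1) * (2 * l) ^+ k.-1.
  transitivity (\sum_(a in A) w a * (('X + l%:P) ^+ k.-1).[a] +
      \sum_(a in A) if a == l then w l * ((2 * l) ^+ M - 1) * (2 * l) ^+ k.-1 else 0).
    rewrite -big_split; apply: eq_bigr => a aA /=; rewrite horner_exp hornerD hornerX hornerC.
    case: eqVneq => [->|nal]; first by rewrite [l + l](_ : _ = 2 * l) ?exprD; ring.
    by rewrite exprD sumA // 1?eq_sym // mul1r expr0 mulr1 addr0 [l + a]addrC.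
  rewrite sum_weight_eq0 ?size_XaddC_exp ?add0r; last by lia.
  by rewrite -big_mkcondr (bigD1 l) ?lA ?eqxx //= big1 ?addr0 // => a /andP[/andP[_ ->]].
have -> : \sum_(a in A) w a * ((l + a) ^+ (M + k.-1 - k) * (l - a) ^+ k) =
    - (2 * l) ^+ k * (-1) ^+ eps * l ^+ eps / \prod_(b in A) (- l - b).
  (* Divide [(X - l)^k] by [X + l]: the quotient [Y] has degree below [k] and is killed by the
     weights, and the remainder [(- 2 l)^k] leaves the partial fraction sum. *)
  have /factor_theorem[Y eY] : root (('X - l%:P) ^+ k - ((- (2 * l)) ^+ k)%:P) (- l).
    rewrite /root hornerD hornerN horner_exp hornerXsubC hornerC.
    by rewrite -opprD -mulr2n mulr_natl subrr.
  have eYa a : (a - l) ^+ k = Y.[a] * (l + a) + (- (2 * l)) ^+ k.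
    have := congr1 (horner^~ a) eY.
    rewrite hornerD hornerN horner_exp hornerXsubC hornerC hornerM hornerXsubC opprK.
    by rewrite [l + a]addrC => /eqP; rewrite subr_eq => /eqP.
  have sY : (size Y <= k)%N.
    have [->|Y0] := eqVneq Y 0; first by rewrite size_poly0.
    have : (size (Y * ('X - (- l)%:P))%R <= k.+1)%N.
      rewrite -eY (leq_trans (size_polyD _ _)) // size_polyN geq_max size_exp_XsubC leqnn.
      exact: leq_trans (size_polyC_leq1 _) _.
    by rewrite size_Mmonic ?monicXsubC // size_XsubC addn2.
  transitivity ((-1) ^+ k * (\sum_(a in A) w a * Y.[a]) +
     (2 * l) ^+ k * \sum_(a in A) w a / (l + a)).
    rewrite !mulr_sumr -big_split; apply: eq_bigr => a aA /=.
    have la : l + a != 0.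
      by apply: contraNneq lNA => /eqP; rewrite addr_eq0 => /eqP ->; rewrite opprK.
    have -> : (l + a) ^+ (M + k.-1 - k) * (l - a) ^+ k = (l - a) ^+ k / (l + a).
      have [->|nal] := eqVneq a l; first by rewrite subrr expr0n gtn_eqF // mulr0 mul0r.
      rewrite mulrC; congr (_ * _); apply: (mulIf la); rewrite mulVf // -exprSr.
      have M0 := half_card_gt0 oddF.
      have -> : (M + k.-1 - k).+1 = M by move: M0 k_gt0; clear; lia.
      by rewrite sumA // eq_sym.
    rewrite -[l - a]opprB [(- (a - l)) ^+ k]exprNn eYa [(- (2 * l)) ^+ k]exprNn.
    by rewrite mulrDr signrMK; field.
  rewrite sum_weight_div // sum_weight_eq0; last first.
    by move: (size Y) sY => n; lia.
  by ring.
move=> H; have c0 : l ^+ eps * (2 * l) ^+ k.-1 != 0 by rewrite mulf_neq0 ?expf_neq0.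
apply: (mulIf c0); apply/eqP; rewrite -subr_eq0 -[X in _ == X]H.
have -> : (2 * l) ^+ k = (2 * l) * (2 * l) ^+ k.-1 by rewrite -exprS prednK.
by rewrite -[_ *+ 'C(_, _)]mulr_natr; apply/eqP; ring.
Qed.

End Stepanov.

(** As [#|A|] is even, the product is [G.[a]] for the monic [G] with root set [-A]. Write [G.[a] / a
    = Q.[a] + G.[0] / a] with [Q] monic of degree [#|A| - 1]: the first part sums to [1], the second
    to [-1]. *)
Lemma sum_lagrange_weight_reflect (F : finFieldType) (A : {set F}) :
  ~~ odd #|A| -> A != set0 -> 0 \notin A ->
  \sum_(a in A) lagrange_weight A a * \prod_(b in A) (- a - b) / a = 0.
Proof.
move=> evA A0 zA.
pose G := \prod_(b in A) ('X - (- b)%:P) : {poly F}.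
have sG : size G = #|A|.+1 by rewrite /G -big_enum size_prod_XsubC -cardE.
have mG : G \is monic by rewrite /G -big_enum monic_prod_XsubC.
have Ga a : \prod_(b in A) (- a - b) = G.[a].
  rewrite /G horner_prod.
  transitivity (\prod_(b in A) (-1 * (a - - b))); first by apply: eq_bigr => b _; ring.
  rewrite big_split /= prodr_const -signr_odd (negPf evA) expr0 mul1r.
  by apply: eq_bigr => b _; rewrite hornerXsubC.
have /factor_theorem[Q eQ] : root (G - G.[0]%:P) 0 by rewrite /root !hornerE subrr.
rewrite subr0 in eQ.
have N0 : (0 < #|A|)%N by rewrite card_gt0.
have cQ : Q`_(#|A|.-1) = 1.
  have := congr1 (fun p : {poly F} => p`_#|A|) eQ.
  rewrite coefB coefC gtn_eqF // subr0 coefMX gtn_eqF // => <-.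
  by rewrite -(monicP mG) /lead_coef sG.
have sQ : (size Q <= #|A|)%N.
  have [->|Q0] := eqVneq Q 0; first by rewrite size_poly0.
  rewrite -ltnS -(size_mulX Q0) -eQ -sG.
  apply: leq_trans (size_polyD _ _) _; rewrite size_polyN geq_max leqnn sG.
  exact: leq_trans (size_polyC_leq1 _) _.
have e a : a \in A -> G.[a] / a = Q.[a] - G.[0] * (0 - a)^-1.
  move=> aA; have a0 : a != 0 by apply: contraNneq zA => <-.
  have := congr1 (horner^~ a) eQ; rewrite !hornerE => /eqP; rewrite subr_eq => /eqP ->.
  by rewrite invrN; field.
transitivity (\sum_(a in A) lagrange_weight A a * Q.[a] -
    G.[0] * \sum_(a in A) lagrange_weight A a / (0 - a)).
  rewrite mulr_sumr -sumrB; apply: eq_bigr => a aA.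
  by rewrite Ga -mulrA e // mulrBr; congr (_ - _); rewrite mulrCA.
rewrite sum_lagrange_weight // cQ sum_lagrange_weight_div // -Ga oppr0.
by rewrite divff ?subrr // prod_sub_eq0.
Qed.

Lemma card_offdiag (T : finType) (A : {set T}) :
  #|[set p in setX A A | p.1 != p.2]| = (#|A| * #|A|.-1)%N.
Proof.
have <- : setX A A :\: [set (a, a) | a in A] = [set p in setX A A | p.1 != p.2].
  apply/setP=> -[a b]; rewrite !inE /= [RHS]andbC.
  case: (boolP ((a \in A) && (b \in A))) => [/andP[aA _]|]; last by rewrite !andbF.
  rewrite !andbT; congr (~~ _); apply/imsetP/eqP => [[c _ [-> ->]] //|<-].
  by exists a.
rewrite cardsD cardsX (setIidPr _); last first.
  by apply/subsetP => _ /imsetP[a aA ->]; rewrite !inE aA.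
rewrite card_imset => [|a b [->] //]; case: #|A| => [|n] //=; lia.
Qed.

(** * Counting representations of squares as sums *)

Section SumsetOfSquares.

Variable F : finFieldType.
Hypothesis oddF : odd #|F|.
Variable A : {set F}.
Hypothesis sumsetA : restricted_sumset A = nonzero_squares F.

Notation q := #|F|.
Notation M := (#|F|.-1./2).
Notation N := #|A|.
Notation R := (nonzero_squares F).

Lemma sum_in_squares (a b : F) : a \in A -> b \in A -> a != b -> a + b \in R.
Proof. by move=> aA bA nab; rewrite -sumsetA; apply/imset2P; exists a b; rewrite ?inE ?bA. Qed.

Lemma chi_sum (a b : F) : a \in A -> b \in A -> a != b -> chi (a + b) = 1.
Proof. by move=> aA bA nab; apply/eqP; rewrite chi_eq1 // sum_in_squares. Qed.

Lemma expf_sum : {in A &, forall a b, a != b -> (a + b) ^+ M = 1}.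
Proof. by move=> a b aA bA nab; rewrite chiE // chi_sum. Qed.

Definition reps (y : F) := [set p in setX A A | (p.1 != p.2) && (p.1 + p.2 == y)].

Lemma reps_ge2 (y : F) : y \in R -> (2 <= #|reps y|)%N.
Proof.
rewrite -sumsetA => /imset2P[a b aA]; rewrite inE => /andP[bA nab] ->.
have -> : 2%N = #|[set (a, b); (b, a)]| by rewrite cards2 xpair_eqE negb_and nab.
apply/subset_leq_card/subsetP => p; rewrite !inE => /orP[] /eqP -> /=.
  by rewrite aA bA nab eqxx.
by rewrite aA bA eq_sym nab addrC eqxx.
Qed.

Lemma sum_card_reps : (\sum_y #|reps y| = N * N.-1)%N.
Proof.
rewrite -card_offdiag -sum1_card (partition_big (fun p => p.1 + p.2) predT) //=.
apply: eq_bigr => y _; rewrite -sum1_card; apply: eq_bigl => p.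
by rewrite !inE andbA.
Qed.

Lemma sum_squares_indicator : \sum_(y : F) 2 * (y \in R)%:R = q%:Z - 1.
Proof.
rewrite -(eq_bigr _ (fun y _ => nonzero_squares_indicator oddF y)).
rewrite sumrB big_split /= sum_chi // addr0 sumr_const.
by rewrite (bigD1 0) //= eqxx big1 ?addr0 ?natz // => y /negPf ->.
Qed.

Lemma card_pred_le : (q.-1 <= N * N.-1)%N.
Proof.
have : \sum_(y : F) 2 * (y \in R)%:R <= (\sum_y #|reps y|)%N%:Z.
  rewrite (big_morph Posz PoszD (erefl 0%:Z)); apply: ler_sum => y _.
  by have [yR|yR] := boolP (y \in R); [have := reps_ge2 yR; lia | lia].
rewrite sum_squares_indicator sum_card_reps; lia.
Qed.

Lemma cardA_gt1 : (1 < N)%N.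
Proof. have := card_pred_le; have := half_card_gt0 oddF; case: N => [|[|]] //=; lia. Qed.

(** * The second moment of the character sum over [A] *)

Definition chi_sumset (x : F) : int := \sum_(a in A) chi (x + a).
Notation S := chi_sumset.

Lemma sum_chi_sumset : \sum_x S x = 0.
Proof. by rewrite exchange_big big1 //= => a _; rewrite sum_chi_shift. Qed.

Lemma sum_chi_sumset_sqr : \sum_x S x ^+ 2 = N%:Z * (q%:Z - N%:Z).
Proof.
transitivity (\sum_(a in A) \sum_(b in A) \sum_x chi (x + a) * chi (x + b)).
  under [RHS]eq_bigr do rewrite exchange_big.
  rewrite [RHS]exchange_big; apply: eq_bigr => x _ /=.
  by rewrite expr2 mulr_suml; apply: eq_bigr => a _; rewrite mulr_sumr.
transitivity (\sum_(a in A) (q%:Z - N%:Z)); last by rewrite sumr_const -mulr_natl natz.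
apply: eq_bigr => a aA.
under eq_bigr do rewrite sum_chi_shift2 //.
transitivity (\sum_(b in A) ((if b == a then q%:Z else 0) - 1)).
  by apply: eq_bigr => b _; rewrite eq_sym; case: eqP.
rewrite sumrB sumr_const natz -big_mkcondr (bigD1 a) ?aA ?eqxx //= big1 ?addr0 //.
by move=> b /andP[/andP[_ ->]].
Qed.

Lemma chi_sumset_mem (x : F) : x \in A -> S x = N%:Z - 1 + chi (2 * x).
Proof.
move=> xA; rewrite /S (bigD1 x) //= addrC.
rewrite (eq_bigr (fun=> 1)) => [|a /andP[aA nax]]; last by rewrite chi_sum // eq_sym.
rewrite sumr_const mulr_natl mulr2n; congr (_ + _).
rewrite natz [in RHS](cardD1 x A) xA /= PoszD addrC addKr; congr (Posz _).
by apply: eq_card => a; rewrite !inE andbC.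
Qed.

(** Otherwise [S l = N] at each nonzero [l] in [A], so the second moment is at least [(N - 1) N^2];
    but [q - 1 <= N (N - 1)] bounds it by [N (N - 1)^2]. *)
Lemma exists_bad : exists l, [/\ l \in A, l != 0 & chi (2 * l) = -1].
Proof.
have [/existsP[l /and3P[lA l0 /eqP]]|/existsPn h] :=
  boolP [exists l, [&& l \in A, l != 0 & chi (2 * l) == -1]].
  by exists l.
have hl l : l \in A :\ 0 -> S l ^+ 2 = N%:Z ^+ 2.
  rewrite !inE => /andP[l0 lA]; rewrite chi_sumset_mem //.
  have := h l; rewrite lA l0 /=.
  have l2 : 2 * l != 0 by rewrite mulf_neq0 ?two_neq0.
  by case: (chi_neq0 l2) => -> //; rewrite subrK.
have le : \sum_(l in A :\ 0) S l ^+ 2 <= \sum_x S x ^+ 2.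
  by rewrite [leRHS](bigID (mem (A :\ 0))) /= lerDl sumr_ge0 // => x _; apply: sqr_ge0.
exfalso; move: le.
rewrite (eq_bigr _ hl) sumr_const sum_chi_sumset_sqr -mulr_natl natz.
have := cardsD1 0 A; have := card_pred_le; have := cardA_gt1; have := card_odd_field oddF.
move: #|A :\ 0| N => n N'; case: (0 \in A) => /=; nia.
Qed.

(** * Consequences of the Stepanov relation *)

Lemma relation_half (l : F) : l \in A -> l != 0 ->
  lagrange_weight A l * ((chi (2 * l))%:~R - 1) =
  'C(M + N./2.-1, N./2)%:R * (2 * l) / \prod_(b in A) (- l - b).
Proof.
move=> lA l0.
have := @stepanov_relation F oddF A expf_sum N./2 false _ _ l _ lA l0.
rewrite mul1r chiE //; apply.
- have := cardA_gt1; lia.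
- lia.
- have := card_pred_le; have := cardA_gt1; have := card_odd_field oddF.
  move: M => m ->; nia.
Qed.

Lemma two_lagrange_weight_neq0 (l : F) : lagrange_weight A l * ((- 1)%:~R - 1) != 0.
Proof.
rewrite mulf_neq0 ?lagrange_weight_neq0 //.
by rewrite -opprD oppr_eq0 two_neq0.
Qed.

(** For a bad element the left side of the relation is nonzero, hence so is each factor on the
    right. *)
Lemma binomial_neq0 : 'C(M + N./2.-1, N./2)%:R != 0 :> F.
Proof.
have [l [lA l0 cl]] := exists_bad.
have := relation_half lA l0; rewrite cl => e.
have := two_lagrange_weight_neq0 l; rewrite e.
by apply: contraNneq => ->; rewrite !mul0r.
Qed.

(** If [chi (2 * l)] were [1], the left side of the relation would vanish while every factor on the
    right is nonzero. *)
Lemma all_bad (l : F) : l \in A -> l != 0 -> chi (2 * l) = -1.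
Proof.
move=> lA l0; have l2 : 2 * l != 0 by rewrite mulf_neq0 ?two_neq0.
case: (chi_neq0 l2) => // c1.
have := relation_half lA l0; rewrite c1 subrr mulr0 => /esym/eqP.
rewrite !mulf_eq0 (negPf binomial_neq0) -mulf_eq0 (negPf l2) invr_eq0 prod_sub_eq0.
by rewrite (negPf (opp_notin oddF expf_sum lA l0)).
Qed.

(** With [N = 2k + 1] the choice [eps = 1] raises the degree by one, which a strict counting
    inequality can afford. The two choices of [eps] then equate the same left side with opposite
    right sides. *)
Lemma card_odd_set : odd N -> (q.-1 = N * N.-1)%N.
Proof.
move=> oN; apply/eqP; rewrite eqn_leq card_pred_le /= leqNgt; apply/negP => lt.
have [l [lA l0 cl]] := exists_bad.
have := @stepanov_relation F oddF A expf_sum N./2 true _ _ l _ lA l0.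
rewrite chiE // cl expr1 mulN1r !mulNr.
have := relation_half lA l0; rewrite cl => <- h.
have e : lagrange_weight A l * ((-1)%:~R - 1) = - (lagrange_weight A l * ((-1)%:~R - 1)).
  apply: h.
  - have := cardA_gt1; lia.
  - lia.
  - have eN : N = N./2.*2.+1 by lia.
    have := card_odd_field oddF; move: lt eN; move: M N./2 q N => m h q' n.
    move=> lt eN eq; move: lt; rewrite eN eq; clear; nia.
have := two_lagrange_weight_neq0 l; move/eqP: e; rewrite -addr_eq0 -mulr2n -mulr_natl mulf_eq0.
by rewrite (negPf (two_neq0 oddF)) /= => ->.
Qed.

(** * Even [N]: parity and the exact size of the field *)

Lemma chi_sumset_even (x : F) : ~~ odd N -> - x \notin A -> 1 <= (S x + 1) ^+ 2.
Proof.
move=> evN xA.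
have -> : S x = N%:Z - 2 * \sum_(a in A) (chi (x + a) == -1)%:R.
  rewrite mulr_sumr -[N%:Z]natz -sumr_const -sumrB; apply: eq_bigr => a aA.
  have xa : x + a != 0.
    by apply: contraNneq xA => /eqP; rewrite addr_eq0 => /eqP ->; rewrite opprK.
  by case: (chi_neq0 xa) => ->.
move: (\sum_(a in A) _) => m.
(* An even number of signs has an even sum, so [S x + 1] is odd. *)
have : N%:Z - 2 * m + 1 != 0 by lia.
move: (_ + 1) => z; nia.
Qed.

Lemma sum_chi_sumset_add1_sqr :
  \sum_x (S x + 1) ^+ 2 = N%:Z * (q%:Z - N%:Z) + q%:Z.
Proof.
transitivity (\sum_x (S x ^+ 2 + 2 * S x + 1)); first by apply: eq_bigr => x _; ring.
rewrite !big_split /= sum_chi_sumset_sqr -mulr_sumr sum_chi_sumset mulr0 addr0.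
by rewrite sumr_const natz.
Qed.

Lemma sum_indicator (B : {set F}) : \sum_x (x \in B)%:R = #|B|%:Z.
Proof.
rewrite -[RHS]natz -sumr_const [RHS]big_mkcond; apply: eq_bigr => x _.
by case: (x \in B).
Qed.

(** Pointwise bounds for [(S x + 1) ^+ 2]: it equals [(N - 1)^2] at nonzero points of [A] and [N^2]
    at [0] if [0] is in [A], is at least [1] outside [A] and [-A], and is at least [0] elsewhere. *)
Lemma parity_bound : ~~ odd N ->
  N%:Z * (N%:Z - 1) ^+ 2 + q%:Z - 2 * N%:Z + (2 * N%:Z - 1) * (0 \in A)%:R <=
  N%:Z * (q%:Z - N%:Z) + q%:Z.
Proof.
move=> evN; rewrite -sum_chi_sumset_add1_sqr.
have -> : N%:Z * (N%:Z - 1) ^+ 2 + q%:Z - 2 * N%:Z + (2 * N%:Z - 1) * (0 \in A)%:R =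
    \sum_(x : F) ((N%:Z - 1) ^+ 2 * (x \in A)%:R + 1 - (x \in A)%:R - (- x \in A)%:R
       + (2 * N%:Z - 1) * ((x == 0) && (0 \in A))%:R).
  have e : \sum_(x : F) ((- x \in A)%:R : int) = N%:Z.
    by rewrite -(sum_indicator A) [RHS](reindex_inj oppr_inj).
  have e0 : \sum_(x : F) (((x == 0) && (0 \in A))%:R : int) = (0 \in A)%:R.
    by rewrite (bigD1 0) //= eqxx big1 ?addr0 // => x /negPf ->.
  rewrite !big_split /= !sumrN -!mulr_sumr sum_indicator e e0 sumr_const natz.
  ring.
apply: ler_sum => x _.
have N1 : 1 < N%:Z by have := cardA_gt1; lia.
have [xA|xA] := boolP (x \in A).
  rewrite chi_sumset_mem //.
  have [->|x0] /= := eqVneq x 0.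
    rewrite mulr0 chi0; case: (_ \in A); case: (_ \in A);
      rewrite /= ?mulr1n ?mulr0n; lra.
  by rewrite all_bad //; case: (_ \in A); rewrite /= ?mulr1n ?mulr0n; lra.
have -> : ((x == 0) && (0 \in A)) = false.
  by case: eqP xA => // -> /negPf.
have [nxA|nxA] := boolP (- x \in A); first by have := sqr_ge0 (S x + 1); move: (_ ^+ 2); lia.
by have := chi_sumset_even evN nxA; move: ((_ + 1) ^+ 2); lia.
Qed.

Lemma card_field_eq : (q = (N * N.-1).+1)%N.
Proof.
have [oN|evN] := boolP (odd N).
  by rewrite -card_odd_set // prednK // card_odd_field.
have N1 := cardA_gt1; have le := card_pred_le; have eq2 := card_odd_field oddF.
have pb := parity_bound evN.
have [//|ne] := eqVneq q (N * N.-1).+1.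
have ev : ~~ odd (N * N.-1) by rewrite oddM (negPf evN).
have NN : (N * N.-1)%N%:Z = N%:Z * (N%:Z - 1) by lia.
(* The moment bound gives [q >= N (N - 1) - 1]; since [q] is odd and [N (N - 1)] even, this is the
   only other value left. *)
have eq1 : (q.+1 = N * N.-1)%N.
  have : (N * N.-1)%N%:Z - 1 <= q%:Z.
    rewrite NN; move: pb; case: (0 \in A); move: N1; clear; nia.
  move: ev eq2 le ne; clear; move: (N * N.-1)%N M q => n m q' /= ev eq2 le ne; lia.
have zA : 0 \notin A.
  move: pb NN; rewrite -eq1; case: (0 \in A) => //; move: N1; clear; nia.
have A0 : A != set0 by rewrite -card_gt0; lia.
have := sum_lagrange_weight_reflect evN A0 zA.
(* As all elements are bad, the relation determines each weight, and every summand equals minus the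
   same binomial coefficient. Hence [N = 0] in [F], and [q + 1 = N (N - 1)] becomes [1 = 0]. *)
rewrite (eq_bigr (fun=> - 'C(M + N./2.-1, N./2)%:R)).
  rewrite sumr_const -[X in X = _]mulr_natl => /eqP.
  rewrite mulf_eq0 oppr_eq0 (negPf binomial_neq0) orbF => /eqP N0.
  have := natr_card_finField F; have := congr1 (fun n => n%:R : F) eq1.
  rewrite natrM N0 mul0r -natr1 => e e'; move: e; rewrite e' add0r => /eqP.
  by rewrite oner_eq0.
move=> a aA; have a0 : a != 0 by apply: contraNneq zA => <-.
have := relation_half aA a0; rewrite all_bad //.
have P0 : \prod_(b in A) (- a - b) != 0.
  by rewrite prod_sub_eq0 (opp_notin oddF expf_sum aA a0).
have i2 := two_neq0 oddF.
move: (\prod_(b in A) (- a - b)) P0 => P P0.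
move: (lagrange_weight A a) => c e.
have ec : c = - ('C(M + N./2.-1, N./2)%:R * a / P).
  apply: (mulIf (x := -2)); first by rewrite oppr_eq0.
  have -> : -2 = (-1)%:~R - 1 :> F by rewrite -opprD.
  by rewrite e; field.
by rewrite ec; field; apply/andP.
Qed.

(** * The perfect difference set *)

Lemma card_reps (y : F) : #|reps y|%:Z = 2 * (y \in R)%:R.
Proof.
have ge0 x : 0 <= #|reps x|%:Z - 2 * (x \in R)%:R.
  by have [xR|xR] := boolP (x \in R); [have := reps_ge2 xR; lia | lia].
(* The excesses are nonnegative, and the value of [q] makes their total [0]. *)
have sum0 : \sum_x (#|reps x|%:Z - 2 * (x \in R)%:R) = 0.
  rewrite sumrB -(big_morph Posz PoszD (erefl 0%:Z)) sum_card_reps sum_squares_indicator.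
  have := card_field_eq; lia.
by apply/eqP; rewrite -subr_eq0; apply/eqP/(psumr_eq0P (fun x _ => ge0 x) sum0).
Qed.

Lemma sum_pairs_add (phi : F -> int) :
  \sum_(a in A) \sum_(b in A) phi (a + b) =
  \sum_y 2 * (y \in R)%:R * phi y + \sum_(a in A) phi (2 * a).
Proof.
transitivity (\sum_(a in A) (\sum_(b in A | a != b) phi (a + b) + phi (2 * a))).
  apply: eq_bigr => a aA; rewrite (bigD1 a) //= addrC mulr_natl mulr2n.
  by congr (_ + _); apply: eq_bigl => b; rewrite eq_sym.
rewrite big_split /=; congr (_ + _).
rewrite pair_big_dep /= (partition_big (fun p => p.1 + p.2) predT) //=.
apply: eq_bigr => y _; rewrite -card_reps -[#|_|%:Z]natz mulr_natl -sumr_const.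
apply: eq_big => [p|p]; first by rewrite !inE -!andbA.
by case/andP=> _ /eqP ->.
Qed.

Lemma double_notin_squares (a : F) : a \in A -> 2 * a \notin R.
Proof.
move=> aA; rewrite -chi_eq1 //.
by have [->|a0] := eqVneq a 0; [rewrite mulr0 chi0 | rewrite all_bad].
Qed.

Definition offdiag := [set p in setX A A | p.1 != p.2].

(** Rewrite [a - b = c - d] as [a + d = c + b]. If exactly one side is a double, a double would be a
    square; if both are, then [a = b]; otherwise uniqueness of representations applies. *)
Lemma sub_inj_offdiag : {in offdiag &, injective (fun p => p.1 - p.2)}.
Proof.
move=> [a b] [c d]; rewrite !inE /= => /andP[/andP[aA bA] nab] /andP[/andP[cA dA] ncd] e.
have e' : a + d = c + b.
  by apply/eqP; rewrite addrC -subr_eq -addrA addrC -subr_eq0; apply/eqP; rewrite e; ring.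
have dbl x : x + x = 2 * x :> F by ring.
have nad : a != d.
  apply/eqP => ad; move: e'; rewrite -ad dbl => e'.
  have [cb|ncb] := eqVneq c b.
    move: e'; rewrite cb dbl => /(mulfI (two_neq0 oddF)) ab.
    by rewrite ab eqxx in nab.
  by have := double_notin_squares aA; rewrite e' sum_in_squares.
have ncb : c != b.
  apply/eqP => cb; move: e'; rewrite -cb dbl => e'.
  by have := double_notin_squares cA; rewrite -e' sum_in_squares.
have yR : a + d \in R by apply: sum_in_squares.
have c2 : #|reps (a + d)| = 2%N by have := card_reps (a + d); rewrite yR; lia.
have : (c, b) \in [set (a, d); (d, a)].
  have <- : reps (a + d) = [set (a, d); (d, a)].
    apply/esym/eqP; rewrite eqEcard c2 cards2 xpair_eqE negb_and nad andbT.
    apply/subsetP => p; rewrite !inE => /orP[] /eqP -> /=.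
      by rewrite aA dA nad eqxx.
    by rewrite aA dA eq_sym nad addrC eqxx.
  by rewrite !inE /= cA bA ncb e' eqxx.
rewrite !inE => /orP[] /eqP [ec eb]; first by rewrite ec eb.
by rewrite ec eqxx in ncd.
Qed.

(** The [N (N - 1) >= q - 1] differences of distinct elements are distinct and nonzero, so they fill
    the nonzero elements exactly once. *)
Lemma sum_pairs_sub (phi : F -> int) :
  \sum_(a in A) \sum_(b in A) phi (a - b) = (N%:Z - 1) * phi 0 + \sum_t phi t.
Proof.
transitivity (\sum_(a in A) (\sum_(b in A | a != b) phi (a - b) + phi 0)).
  apply: eq_bigr => a aA; rewrite (bigD1 a) //= addrC subrr.
  by congr (_ + _); apply: eq_bigl => b; rewrite eq_sym.
rewrite big_split /= sumr_const -[phi 0 *+ _]mulr_natl natz.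
suff -> : \sum_(a in A) \sum_(b in A | a != b) phi (a - b) = \sum_(t | t != 0) phi t.
  by rewrite [in RHS](bigD1 0) //=; ring.
rewrite pair_big_dep /=.
transitivity (\sum_(p in offdiag) phi (p.1 - p.2)).
  by apply: eq_bigl => p; rewrite !inE andbA.
rewrite -(big_imset phi sub_inj_offdiag) /=.
have -> : [set p.1 - p.2 | p in offdiag] = [set~ 0].
  apply/eqP; rewrite eqEcard (card_in_imset sub_inj_offdiag) card_offdiag cardsC1.
  rewrite card_pred_le andbT; apply/subsetP => _ /imsetP[p pO ->].
  by move: pO; rewrite !inE subr_eq0 => /andP[].
by apply: eq_bigl => t; rewrite !inE.
Qed.

Lemma sum_pairs_eq (phi psi : F -> F -> int) :
  (forall a b, phi a b = psi a b) ->
  \sum_(a in A) \sum_(b in A) phi a b = \sum_(a in A) \sum_(b in A) psi a b.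
Proof. by move=> e; apply: eq_bigr => a _; apply: eq_bigr => b _. Qed.

Lemma sum_delta (t : F) (phi : F -> int) : \sum_y phi y * (y == t)%:R = phi t.
Proof.
by rewrite (bigD1 t) //= eqxx mulr1 big1 ?addr0 // => y /negPf ->; rewrite mulr0.
Qed.

Lemma sum_delta1 (t : F) : \sum_(y : F) ((y == t)%:R : int) = 1.
Proof. by rewrite -[RHS](sum_delta t (fun=> 1)); apply: eq_bigr => y _; rewrite mul1r. Qed.

Lemma sum_delta_set (t : F) : \sum_(a in A) ((a == t)%:R : int) = (t \in A)%:R.
Proof.
rewrite -(sum_delta t (fun y => (y \in A)%:R)) big_mkcond /=.
by apply: eq_bigr => y _; case: (y \in A); rewrite ?mul1r ?mul0r.
Qed.

Lemma sum_delta_double (z : F) :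
  \sum_(b in A) ((2 * b == z)%:R : int) =
  \sum_(b in A) \sum_(c in A) (b + c == z)%:R - 2 * (z \in R)%:R.
Proof.
rewrite (sum_pairs_add (fun y => (y == z)%:R)).
by rewrite (sum_delta z (fun y => 2 * (y \in R)%:R)) addrC addKr.
Qed.

Lemma sum_squares_double (t : F) :
  \sum_(b in A) 2 * (2 * b - 2 * t \in R)%:R = N%:Z + chi (2 : F) * S (- t) - (t \in A)%:R.
Proof.
rewrite -sum_delta_set -[N%:Z]natz -sumr_const mulr_sumr -big_split -sumrB /=.
apply: eq_bigr => b _; rewrite -nonzero_squares_indicator // -mulrBr chiM // addrC.
rewrite mulf_eq0 (negPf (two_neq0 oddF)) subr_eq0 /=.
by congr (_ - _); rewrite [in RHS]addrC; congr (1 + _ * chi _); rewrite addrC.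
Qed.

Lemma sum_squares_chi (x : F) : x != 0 ->
  \sum_y 2 * (y \in R)%:R * chi (x + y) = -1 - chi x.
Proof.
move=> x0.
transitivity (\sum_y (chi (y + x) + chi y * chi (y + x) - chi (x + y) * (y == 0)%:R)).
  by apply: eq_bigr => y _; rewrite -nonzero_squares_indicator // [x + y]addrC; ring.
rewrite sumrB big_split /= sum_chi_shift // sum_chi_mul_shift // add0r.
by rewrite (sum_delta 0 (fun y => chi (x + y))) addr0.
Qed.

(** Regrouped as [b' - d = x - (b - c)], the count follows from two uses of the difference
    property. *)
Lemma sum_quadruples (x : F) : x != 0 ->
  \sum_(c in A) \sum_(d in A) \sum_(b in A) \sum_(b' in A)
    ((b + b' == x + (c + d))%:R : int) = 2 * (N%:Z - 1) + q%:Z.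
Proof.
move=> x0.
transitivity (\sum_(b in A) \sum_(c in A) ((N%:Z - 1) * (b - c == x)%:R + 1)).
  rewrite [RHS]exchange_big; apply: eq_bigr => c _ /=.
  rewrite exchange_big; apply: eq_bigr => b _ /=.
  rewrite exchange_big /=.
  transitivity (\sum_(b' in A) \sum_(d in A) ((b' - d == x - (b - c))%:R : int)).
    apply: sum_pairs_eq => b' d; congr (nat_of_bool _)%:R.
    rewrite -subr_eq0 -[RHS]subr_eq0; congr (_ == 0); ring.
  rewrite (sum_pairs_sub (fun t => (t == x - (b - c))%:R)) sum_delta1.
  by rewrite eq_sym subr_eq0 [x == _]eq_sym.
rewrite (sum_pairs_sub (fun t => (N%:Z - 1) * (t == x)%:R + 1)).
rewrite big_split /= -mulr_sumr sum_delta1 sumr_const natz [0 == x]eq_sym (negPf x0) mulr0.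
ring.
Qed.

(** The single solution of [2 b - 2 c = 2 l] is recounted by trading each indicator of a double for
    pair sums minus squares, first for [2 c] and then for [2 b]. *)
Lemma chi_sumset_opp (l : F) : l \in A -> l != 0 ->
  chi (2 : F) * (S l + S (- l)) = chi (2 * l) + 2 * (- (2 * l) \in R)%:R.
Proof.
move=> lA l0; set x := 2 * l.
have i2 := two_neq0 oddF.
have x0 : x != 0 by rewrite mulf_neq0.
have mul2I := mulfI i2.
have E1 : \sum_(b in A) \sum_(c in A) ((2 * c == 2 * b - x)%:R : int) = 1.
  transitivity (\sum_(b in A) \sum_(c in A) ((b - c == l)%:R : int)).
    apply: sum_pairs_eq => b c; rewrite /x -mulrBr (inj_eq mul2I) eq_sym.
    by rewrite subr_eq [in RHS]subr_eq [c + l]addrC.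
  by rewrite (sum_pairs_sub (fun t => (t == l)%:R)) sum_delta1 eq_sym (negPf l0) mulr0 add0r.
have E2 : \sum_(b in A) \sum_(c in A) \sum_(d in A) ((c + d == 2 * b - x)%:R : int) =
    2 * (N%:Z - 1) + q%:Z - \sum_(c in A) \sum_(d in A) 2 * (x + (c + d) \in R)%:R.
  rewrite -(sum_quadruples x0) -sumrB exchange_big; apply: eq_bigr => c _ /=.
  rewrite -sumrB exchange_big; apply: eq_bigr => d _ /=.
  rewrite -sum_delta_double; apply: eq_bigr => b _.
  congr (nat_of_bool _)%:R; rewrite eq_sym -subr_eq0 -[RHS]subr_eq0.
  by congr (_ == 0); ring.
have E3 : \sum_(c in A) \sum_(d in A) 2 * (x + (c + d) \in R)%:R =
    N%:Z ^+ 2 + (-1 - chi x + chi (2 : F) * S l) - 2 * (- x \in R)%:R.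
  transitivity (\sum_(c in A) \sum_(d in A)
      (1 + chi (x + (c + d)) - (c + d == - x)%:R)).
    apply: sum_pairs_eq => c d; rewrite -nonzero_squares_indicator //.
    by rewrite [in X in X%:R]addrC addr_eq0.
  under eq_bigr do rewrite sumrB big_split /=.
  rewrite sumrB big_split /= !sumr_const -mulrnA natz PoszM -expr2.
  rewrite (sum_pairs_add (fun y => chi (x + y))) sum_squares_chi //.
  rewrite (sum_pairs_add (fun y => (y == - x)%:R)).
  rewrite (sum_delta (- x) (fun y => 2 * (y \in R)%:R)).
  (* No double equals [- x], since [- l] is not in [A]. *)
  rewrite [\sum_(a in A) (2 * a == - x)%:R]big1 => [|a aA].
    rewrite addr0; congr (_ + (_ + _) - _); rewrite mulr_sumr.
    by apply: eq_bigr => a _; rewrite /x -mulrDr chiM.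
  rewrite /x -mulrN (inj_eq mul2I); case: eqP => // al.
  by have := opp_notin oddF expf_sum lA l0; rewrite -al aA.
move: E1; under eq_bigr do rewrite sum_delta_double.
rewrite sumrB E2 E3 sum_squares_double lA.
have : q%:Z = N%:Z ^+ 2 - N%:Z + 1.
  have := card_field_eq; have := cardA_gt1; nia.
by move=> ->; rewrite /= mulr1n; lra.
Qed.

Lemma cardA_le4 : (N <= 4)%N.
Proof.
have sum0 : \sum_(l in A) S (- l) = 0.
  transitivity (\sum_(b in A) \sum_(l in A) chi (b - l)).
    by rewrite exchange_big; apply: eq_bigr => l _; apply: eq_bigr => b _; rewrite addrC.
  by rewrite sum_pairs_sub chi0 mulr0 add0r sum_chi.
(* For nonzero [l], [S l = N - 2] and [S l + S (- l) <= 1]; the extra term at [l = 0] adjusts the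
   bound to [S 0 = N - 1]. *)
have le : \sum_(l in A) S (- l) <=
    \sum_(l in A) (3 - N%:Z + (2 * N%:Z - 4) * (l == 0)%:R).
  apply: ler_sum => l lA; have [l0|l0] := eqVneq l 0.
    by rewrite {1}l0 oppr0 -l0 chi_sumset_mem // l0 mulr0 chi0 /= mulr1n; lra.
  have := chi_sumset_opp lA l0; rewrite chi_sumset_mem // all_bad //.
  by case: (chi_neq0 (two_neq0 oddF)) => ->; case: (_ \in R);
    rewrite /= ?mulr1n ?mulr0n; lra.
move: le; rewrite sum0 big_split /= sumr_const -mulr_sumr sum_delta_set.
rewrite -[_ *+ _]mulr_natl natz; have := cardA_gt1.
case: (0 \in A); rewrite /= ?mulr1n ?mulr0n; nia.
Qed.

End SumsetOfSquares.

Theorem theorem1p1 (F : finFieldType) (hodd : odd #|F|) (hq : (13 < #|F|)%N) :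
  ~ exists A : {set F}, restricted_sumset A = nonzero_squares F.
Proof.
case=> A hA; have := cardA_le4 hodd hA; have := card_field_eq hodd hA.
by move: hq; move: #|F| #|A| => q N; nia.
Qed.
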